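(* The alternation depth of languages definable in $FO^2[<,\mathrm{bet}]$ is unbounded: for every $d\ge 1$ there exist a finite alphabet $A$ and a language $L\subseteq A^*$ definable by a sentence of $FO^2[<,\mathrm{bet}]$ over $A$ whose alternation depth is greater than $d$.
   Context: $FO[<]$ is first-order logic over finite words over a finite alphabet $A$, with the order $<$ on positions and unary predicates $a(x)$ ($a\in A$) meaning the letter at position $x$ is $a$. A formula in prefix form is a block of quantifiers followed by a quantifier-free formula; it is a $\Sigma_k$ formula if its quantifier prefix consists of $k$ alternating blocks of existential and universal quantifiers with the leftmost block existential. The alternation depth of a language $L\subseteq A^*$ definable in $FO[<]$ is the smallest $k$ such that $L$ is defined by a boolean combination of $\Sigma_k$ sentences of $FO[<]$ (with arbitrarily many variables). $FO^2[<,\mathrm{bet}]$ is the fragment of first-order logic using only two variable symbols (reusable), built from $<$, the unary letter predicates, and for each $a\in A$ the binary predicate $a(x,y)$ meaning that some position $z$ with $x<z<y$ carries the letter $a$. *)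

(* Defs.v *)
From mathcomp Require Import all_boot.

Set Implicit Arguments.
Unset Strict Implicit.
Unset Printing Implicit Defensive.

(* One syntax serves both logics: FO[<] is its [bet]-free part, FO^2[<,bet] its
   part mentioning only the variables 0 and 1.  Equality of positions needs no
   atom, being ~ x < y /\ ~ y < x. *)
Inductive formula (A : finType) : Type :=
| FTrue
| FLt of nat & nat
| FLetter of A & nat
| FBet of A & nat & nat
| FNot of formula A
| FAnd of formula A & formula A
| FOr of formula A & formula A
| FEx of nat & formula A
| FAll of nat & formula A.

Arguments FTrue {A}.
Arguments FLt {A}.

Definition update (e : nat -> nat) (x p : nat) : nat -> nat :=
  fun y => if y == x then p else e y.

(* Positions are numbered from 0.  Assignments take values in [nat] so that they
   also exist for the empty word; quantifiers range over the positions of [w]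
   only. *)
Fixpoint sat (A : finType) (w : seq A) (e : nat -> nat) (phi : formula A) :
    bool :=
  match phi with
  | FTrue => true
  | FLt x y => e x < e y
  | FLetter a x => onth w (e x) == Some a
  | FBet a x y =>
      [exists z : 'I_(size w), [&& e x < z, z < e y & onth w z == Some a]]
  | FNot f => ~~ sat w e f
  | FAnd f g => sat w e f && sat w e g
  | FOr f g => sat w e f || sat w e g
  | FEx x f => [exists p : 'I_(size w), sat w (update e x p) f]
  | FAll x f => [forall p : 'I_(size w), sat w (update e x p) f]
  end.

Fixpoint free_vars (A : finType) (phi : formula A) : seq nat :=
  match phi with
  | FTrue => [::]
  | FLt x y => [:: x; y]
  | FLetter _ x => [:: x]
  | FBet _ x y => [:: x; y]
  | FNot f => free_vars f
  | FAnd f g | FOr f g => free_vars f ++ free_vars g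
  | FEx x f | FAll x f => [seq y <- free_vars f | y != x]
  end.

Definition sentence (A : finType) (phi : formula A) : bool :=
  nilp (free_vars phi).

Fixpoint bet_free (A : finType) (phi : formula A) : bool :=
  match phi with
  | FTrue | FLt _ _ | FLetter _ _ => true
  | FBet _ _ _ => false
  | FNot f | FEx _ f | FAll _ f => bet_free f
  | FAnd f g | FOr f g => bet_free f && bet_free g
  end.

(* Bound occurrences count too. *)
Fixpoint two_variable (A : finType) (phi : formula A) : bool :=
  match phi with
  | FTrue => true
  | FLt x y | FBet _ x y => (x < 2) && (y < 2)
  | FLetter _ x => x < 2
  | FNot f => two_variable f
  | FAnd f g | FOr f g => two_variable f && two_variable g
  | FEx x f | FAll x f => (x < 2) && two_variable f
  end.

Fixpoint quantifier_free (A : finType) (phi : formula A) : bool :=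
  match phi with
  | FTrue | FLt _ _ | FLetter _ _ | FBet _ _ _ => true
  | FNot f => quantifier_free f
  | FAnd f g | FOr f g => quantifier_free f && quantifier_free g
  | FEx _ _ | FAll _ _ => false
  end.

Definition quantify (A : finType) (ex : bool) (xs : seq nat) (phi : formula A) :
    formula A :=
  foldr (fun x f => if ex then FEx x f else FAll x f) phi xs.

(* Exactly [k] nonempty alternating blocks, the leftmost one existential if [ex]
   and universal otherwise. *)
Inductive alternating_prefix (A : finType) : bool -> nat -> formula A -> Prop :=
| Alt_matrix ex phi : quantifier_free phi -> alternating_prefix ex 0 phi
| Alt_block ex k xs phi : xs != [::] -> alternating_prefix (~~ ex) k phi ->
    alternating_prefix ex k.+1 (quantify ex xs phi).

Definition sigma_sentence (A : finType) (k : nat) (phi : formula A) : Prop :=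
  [/\ alternating_prefix true k phi, bet_free phi & sentence phi].

Inductive boolean_combination (A : finType) (P : formula A -> Prop) :
    formula A -> Prop :=
| BC_base phi : P phi -> boolean_combination P phi
| BC_not phi : boolean_combination P phi -> boolean_combination P (FNot phi)
| BC_and phi psi : boolean_combination P phi -> boolean_combination P psi ->
    boolean_combination P (FAnd phi psi)
| BC_or phi psi : boolean_combination P phi -> boolean_combination P psi ->
    boolean_combination P (FOr phi psi).

Definition language (A : finType) : Type := seq A -> Prop.

(* The assignment is irrelevant for the sentences this is used with. *)
Definition defines (A : finType) (phi : formula A) (L : language A) : Prop :=
  forall w : seq A, L w <-> sat w (fun=> 0) phi.

Definition FO2_bet_definable (A : finType) (L : language A) : Prop :=
  exists phi : formula A, [/\ two_variable phi, sentence phi & defines phi L].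

Definition bool_sigma_definable (A : finType) (k : nat) (L : language A) :
    Prop :=
  exists phi : formula A,
    boolean_combination (sigma_sentence k) phi /\ defines phi L.

(* A relation because the minimum exists only for FO[<]-definable [L]. *)
Definition alternation_depth (A : finType) (L : language A) (k : nat) : Prop :=
  bool_sigma_definable k L /\ forall j, bool_sigma_definable j L -> k <= j.

(* Main.v *)
Require Import Defs.
From mathcomp Require Import all_boot.
From mathcomp Require Import zify.
From Stdlib Require Import Classical_Prop.

(** Words over the letters 0, ..., n are read as forests in prefix order, a letter
    being the level of its node: the children of a node of level k+1 are the
    letters k that follow it before any letter above k.  Call a node winning if
    some child of it is not winning.  "Child of" is expressible with the between
    predicates, so two variables suffice to say that a root is winning.

    Let T_0 be empty, F_0 the word 0, T_{k+1} = (k+1) T_k^p F_k T_k^p and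
    F_{k+1} = (k+1) T_k^p T_k T_k^p, with p large: the root is winning in T_n and
    not in F_n.  For j <= k, every Sigma_j sentence with few quantifiers true in
    F_k is true in T_k, by an Ehrenfeucht-Fraisse game: the pebbles of a round
    leave a long run of copies of T_{k-1} untouched in F_k, Duplicator inserts
    F_{k-1} into this run, and the two words exchange roles with one round less.
    As F_k and T_k differ only in one block, the same sentences for j < k are
    preserved from T_k to F_k, so no boolean combination of them separates T_k
    from F_k. *)

Set Implicit Arguments.
Unset Strict Implicit.
Unset Printing Implicit Defensive.

(** * Assignments, quantifier blocks and the number of quantifiers *)

Section Semantics.
Variable A : finType.
Implicit Types (w : seq A) (e : nat -> nat) (phi : formula A).

Lemma update_same e x p : update e x p x = p.
Proof. by rewrite /update eqxx. Qed.

Lemma update_other e x y p : y != x -> update e x p y = e y.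
Proof. by rewrite /update => /negbTE ->. Qed.

Lemma eq_sat w e1 e2 phi :
  {in free_vars phi, e1 =1 e2} -> sat w e1 phi = sat w e2 phi.
Proof.
elim: phi e1 e2 => //=.
- by move=> x y e1 e2 E; rewrite !E ?inE ?eqxx ?orbT.
- by move=> a x e1 e2 E; rewrite !E ?inE ?eqxx ?orbT.
- by move=> a x y e1 e2 E; rewrite !E ?inE ?eqxx ?orbT.
- by move=> f IH e1 e2 E; rewrite (IH e1 e2).
- move=> f IHf g IHg e1 e2 E.
  by rewrite (IHf e1 e2) ?(IHg e1 e2) // => x Hx; apply: E; rewrite mem_cat Hx ?orbT.
- move=> f IHf g IHg e1 e2 E.
  by rewrite (IHf e1 e2) ?(IHg e1 e2) // => x Hx; apply: E; rewrite mem_cat Hx ?orbT.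
- move=> x f IH e1 e2 E; apply: eq_existsb => p; apply: IH => y Hy.
  rewrite /update; case: eqP => // /eqP Ny; apply: E.
  by rewrite mem_filter Ny.
- move=> x f IH e1 e2 E; apply: eq_forallb => p; apply: IH => y Hy.
  rewrite /update; case: eqP => // /eqP Ny; apply: E.
  by rewrite mem_filter Ny.
Qed.


Lemma sat_quantify_ex w e xs phi :
  sat w e (quantify true xs phi) <->
  exists2 f : nat -> nat, {in xs, forall x, f x < size w} &
    sat w (fun y => if y \in xs then f y else e y) phi.
Proof.
elim: xs e => [|x xs IH] e /=.
  by split=> [H|[f _ H]] //; exists e.
split.
  case/existsP=> p /IH[f Hf Hsat].
  exists (fun y => if y \in xs then f y else p).
    by move=> y _; case: ifP => // /Hf.
  rewrite (eq_sat _ (e2 := fun y => if y \in xs then f y else update e x p y)) //.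
  move=> y _; rewrite inE /update.
  by case: (y \in xs); rewrite ?orbT // orbF.
case=> f Hf Hsat; apply/existsP.
have Hx : f x < size w by apply: Hf; rewrite mem_head.
exists (Ordinal Hx); apply/IH; exists f.
  by move=> y Hy; apply: Hf; rewrite inE Hy orbT.
rewrite -(eq_sat _ (e1 := fun y => if y \in x :: xs then f y else e y)) //.
move=> y _; rewrite inE /update /=.
by case: (y \in xs); rewrite ?orbT // orbF; case: eqP => // ->.
Qed.

Lemma sat_quantify_all w e xs phi :
  sat w e (quantify false xs phi) = ~~ sat w e (quantify true xs (FNot phi)).
Proof.
elim: xs e => [|x xs IH] e /=; first by rewrite negbK.
by rewrite negb_exists; apply: eq_forallb => p; rewrite IH.
Qed.

(** Being additive, this bounds the pebbles of each single round, and does so uniformly for all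
    sentences occurring in a boolean combination. *)
Fixpoint quantifiers phi : nat :=
  match phi with
  | FTrue | FLt _ _ | FLetter _ _ | FBet _ _ _ => 0
  | FNot f => quantifiers f
  | FAnd f g | FOr f g => quantifiers f + quantifiers g
  | FEx _ f | FAll _ f => (quantifiers f).+1
  end.

Lemma quantifiers_quantify ex xs phi :
  quantifiers (quantify ex xs phi) = size xs + quantifiers phi.
Proof. by elim: xs => //= x xs IH; case: ex IH => /= ->. Qed.

Lemma bet_free_quantify ex xs phi :
  bet_free (quantify ex xs phi) = bet_free phi.
Proof. by elim: xs => //= x xs IH; case: ex IH => /= ->. Qed.

End Semantics.

(** * The Ehrenfeucht-Fraisse game and its soundness for prenex formulas *)

Section Game.
Variable A : finType.

(* A letter with its pebbles, one list per round played, the latest first. *)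
Definition marked : Type := (A * seq (seq nat))%type.
Implicit Types (u v w : seq marked) (m : seq (seq nat)).

Definition touched (b : marked) : bool := has (fun l => l != [::]) b.2.

Definition mark u m : seq marked :=
  [seq (b.1.1, b.2 :: b.1.2) | b <- zip u m].

(* Duplicator wins the [j]-round game in which Spoiler starts in [u] and then
   changes sides every round. *)
Fixpoint game_le (r j : nat) u v : Prop :=
  match j with
  | 0 => filter touched u = filter touched v
  | j.+1 => forall m, size m = size u -> size (flatten m) <= r ->
      exists m', [/\ size m' = size v, size (flatten m') = size (flatten m)
                   & game_le r j (mark v m') (mark u m)]
  end.

Lemma mark_cat u1 u2 m1 m2 : size m1 = size u1 ->
  mark (u1 ++ u2) (m1 ++ m2) = mark u1 m1 ++ mark u2 m2.
Proof. by move=> E; rewrite /mark zip_cat // map_cat. Qed.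

Lemma game_le_refl r j u : game_le r j u u.
Proof. by elim: j u => //= j IH u m Em Hm; exists m. Qed.

Lemma game_le_trans r j v u w :
  game_le r j u v -> game_le r j v w -> game_le r j u w.
Proof.
elim: j u v w => [|j IH] u v w /=; first by move=> ->.
move=> Huv Hvw m Em Hm.
have [m1 [E1 F1 L1]] := Huv m Em Hm.
have [|m2 [E2 F2 L2]] := Hvw m1 E1; first by rewrite F1.
by exists m2; split; rewrite ?F2 //; apply: IH L2 L1.
Qed.

(** Duplicator plays the two given strategies side by side; [r] pebbles on the whole word are at
    most [r] on each factor. *)
Lemma game_le_cat r j u1 v1 u2 v2 :
  game_le r j u1 v1 -> game_le r j u2 v2 -> game_le r j (u1 ++ u2) (v1 ++ v2).
Proof.
elim: j u1 v1 u2 v2 => [|j IH] u1 v1 u2 v2 /=.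
  by rewrite !filter_cat => -> ->.
move=> H1 H2 m; rewrite size_cat -(cat_take_drop (size u1) m).
set m1 := take _ _; set m2 := drop _ _ => Em.
have E1 : size m1 = size u1.
  by move: Em; rewrite size_cat size_take size_drop; case: ltnP; lia.
have E2 : size m2 = size u2 by move: Em; rewrite size_cat E1; lia.
rewrite flatten_cat size_cat => Hm.
have [|m1' [F1 G1 L1]] := H1 m1 E1; first by lia.
have [|m2' [F2 G2 L2]] := H2 m2 E2; first by lia.
exists (m1' ++ m2'); split; first by rewrite !size_cat F1 F2.
  by rewrite flatten_cat size_cat G1 G2.
by rewrite !mark_cat //; apply: IH.
Qed.

Lemma flatten_eq0 m : size (flatten m) = 0 -> m = nseq (size m) [::].
Proof.
elim: m => //= l m IH; rewrite size_cat => E.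
by rewrite -IH; [case: l E | lia].
Qed.

Lemma flatten_nils n : flatten (nseq n [::]) = [::] :> seq nat.
Proof. by elim: n. Qed.

Lemma mark_nils u n : n = size u ->
  mark u (nseq n [::]) = [seq (b.1, [::] :: b.2) | b <- u].
Proof. by move=> ->; rewrite /mark; elim: u => //= b u ->. Qed.

(** Spoiler may place no pebble in any remaining round. Duplicator must place equally many, hence
    none, so the final condition already holds for the present marks. *)
Lemma game_le_touched r j u v :
  game_le r j u v -> filter touched u = filter touched v.
Proof.
elim: j u v => //= j IH u v H.
have [||m' [E F /IH]] := H (nseq (size u) [::]).
- by rewrite size_nseq.
- by rewrite flatten_nils.
move: F; rewrite flatten_nils => /flatten_eq0 ->.
rewrite !mark_nils ?size_nseq // !filter_map => /inj_map Einj.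
by rewrite Einj // => -[a l] [b l'] /= [-> ->].
Qed.

(** The number [c x] tells which round placed [x], 0 being the latest. Without such a pebble, [x]
    sits past the end, at [size u]. *)
Definition pos u (c : nat -> nat) (x : nat) : nat :=
  find (fun b : marked => x \in nth [::] b.2 (c x)) u.

Lemma sub_touched x i : subpred (fun b : marked => x \in nth [::] b.2 i) touched.
Proof.
move=> b Hx; apply/hasP; exists (nth [::] b.2 i); last by case: nth Hx.
by rewrite mem_nth // ltnNge; apply: contraL Hx => Hi; rewrite nth_default.
Qed.

Lemma find_lt_filter (P Q T : pred marked) u : subpred P T -> subpred Q T ->
  (find P u < find Q u) = (find P (filter T u) < find Q (filter T u)).
Proof.
move=> HP HQ; elim: u => //= b u IH.
case ET: (T b) => /=; first by case: (P b); case: (Q b).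
have /negbTE-> : ~~ P b by apply: contraFN ET; apply: HP.
have /negbTE-> : ~~ Q b by apply: contraFN ET; apply: HQ.
exact: IH.
Qed.

Lemma has_filter_sub (P T : pred marked) u : subpred P T ->
  has P (filter T u) = has P u.
Proof.
move=> HP; elim: u => //= b u <-; case ET: (T b) => //=.
by have /negbTE-> : ~~ P b by apply: contraFN ET; apply: HP.
Qed.

Lemma onth_find_filter (P T : pred marked) u : subpred P T ->
  onth (unzip1 u) (find P u) = onth (unzip1 (filter T u)) (find P (filter T u)).
Proof.
move=> HP; elim: u => //= b u IH.
case ET: (T b) => /=; first by case: (P b).
have /negbTE-> : ~~ P b by apply: contraFN ET; apply: HP.
exact: IH.
Qed.

(** Every value of [pos] is a touched position or lies past the end, so deleting the untouched
    letters changes neither the order of these values nor the letters found there. *)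
Lemma sat_matrix u v c (phi : formula A) :
  filter touched u = filter touched v -> quantifier_free phi -> bet_free phi ->
  sat (unzip1 u) (pos u c) phi = sat (unzip1 v) (pos v c) phi.
Proof.
move=> E; elim: phi => //=.
- move=> x y _ _; rewrite /pos.
  by rewrite (find_lt_filter u (@sub_touched _ _) (@sub_touched _ _)) E -find_lt_filter //; apply: sub_touched.
- move=> a x _ _; rewrite /pos.
  by rewrite (onth_find_filter u (@sub_touched _ _)) E -(onth_find_filter v (@sub_touched _ _)).
- by move=> f IH Q B; rewrite IH.
- by move=> f IHf g IHg /andP[? ?] /andP[? ?]; rewrite IHf ?IHg.
- by move=> f IHf g IHg /andP[? ?] /andP[? ?]; rewrite IHf ?IHg.
Qed.

Lemma unzip1_mark u m : size m = size u -> unzip1 (mark u m) = unzip1 u.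
Proof. by rewrite /mark; elim: u m => [|b u IH] [|l m] //= [/IH ->]. Qed.

(* One more round shifts the earlier marks, hence [(c x).+1]. *)
Lemma pos_mark u m c (xs : seq nat) x : size m = size u ->
  pos (mark u m) (fun y => if y \in xs then 0 else (c y).+1) x =
  if x \in xs then find (fun l : seq nat => x \in l) m else pos u c x.
Proof.
rewrite /pos /mark; case: (x \in xs);
  by elim: u m => [|b u IH] [|l m] //= [/IH ->].
Qed.

Definition placement (xs : seq nat) (f : nat -> nat) (n : nat) : seq (seq nat) :=
  mkseq (fun p => [seq x <- xs | f x == p]) n.

Lemma size_placement xs f n : size (flatten (placement xs f n)) <= size xs.
Proof.
rewrite size_flatten sumnE big_map /placement big_map /index_iota -[n in iota _ n]subn0.
elim: xs => [|x xs IH] /=; first by rewrite big1.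
rewrite (eq_bigr (fun p => (f x == p) + size [seq x <- xs | f x == p])); last first.
  by move=> p _; case: eqP.
rewrite big_split /= -add1n leq_add //.
rewrite -big_mkcond /= sum1_count.
rewrite (eq_count (a2 := pred1 (f x))); last by move=> p; rewrite /= eq_sym.
by rewrite count_uniq_mem ?iota_uniq // leq_b1.
Qed.

Lemma find_placement xs f n x : x \in xs -> f x < n ->
  find (fun l : seq nat => x \in l) (placement xs f n) = f x.
Proof.
move=> Hx Hn; rewrite /placement /mkseq find_map.
rewrite (eq_find (a2 := pred1 (f x))).
  rewrite -/(index _ _); have := index_uniq 0 (s := iota 0 n) (i := f x).
  by rewrite size_iota nth_iota ?iota_uniq //; apply.
by move=> p /=; rewrite mem_filter Hx andbT eq_sym.
Qed.

(** One round translated into assignments: Spoiler's choice [f] becomes a placement of pebbles, and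
    Duplicator's answer is read back as the choice [g]. *)
Lemma game_le_move r j u v c xs f :
  game_le r j.+1 u v -> size xs <= r -> {in xs, forall x, f x < size u} ->
  exists u' v' c' g,
  [/\ unzip1 u' = unzip1 u, unzip1 v' = unzip1 v, game_le r j v' u'
    & {in xs, forall x, g x < size v}] /\
  [/\ (fun y => if y \in xs then f y else pos u c y) =1 pos u' c'
    & (fun y => if y \in xs then g y else pos v c y) =1 pos v' c'].
Proof.
move=> H Hr Hf.
have Sm : size (placement xs f (size u)) = size u by rewrite size_mkseq.
have [|m' [Em' Fm' L]] := H _ Sm; first exact: leq_trans (size_placement _ _ _) Hr.
exists (mark u (placement xs f (size u))), (mark v m').
exists (fun y => if y \in xs then 0 else (c y).+1).
exists (fun x => find (fun l : seq nat => x \in l) m').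
have Ef x : x \in xs -> find (fun l : seq nat => x \in l) (placement xs f (size u)) = f x.
  by move=> Hx; apply: find_placement => //; apply: Hf.
split; split=> //; rewrite ?unzip1_mark //.
- move=> x Hx; rewrite -Em' -has_find.
  have Hu : find (fun l : seq nat => x \in l) (placement xs f (size u)) < size u.
    by rewrite Ef //; apply: Hf.
  (* Whether [x] was placed in this round is visible on the touched letters, which agree after the
     round; so each [x] of the block does occur in [m']. *)
  have Hh u0 m0 : size m0 = size u0 ->
      has (fun l : seq nat => x \in l) m0 =
      has (fun b : marked => x \in nth [::] b.2 0) (filter touched (mark u0 m0)).
    move=> E0; rewrite has_filter_sub; last exact: sub_touched.
    by rewrite /mark; elim: u0 m0 E0 => [|b u0 IH] [|l m0] //= [/IH ->].
  by rewrite (Hh v m') // (game_le_touched L) -(Hh u _ Sm) has_find Sm.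
- by move=> x; rewrite pos_mark //; case: ifP => // /Ef ->.
- by move=> x; rewrite pos_mark.
Qed.

(** Induction on the blocks: the change of sides after a round matches the change of quantifier,
    which reverses the implication. *)
Lemma game_le_sat r j ex (phi : formula A) :
  alternating_prefix ex j phi -> bet_free phi -> quantifiers phi <= r ->
  forall u v c, game_le r j u v ->
  if ex then sat (unzip1 u) (pos u c) phi -> sat (unzip1 v) (pos v c) phi
  else sat (unzip1 v) (pos v c) phi -> sat (unzip1 u) (pos u c) phi.
Proof.
elim=> {ex j phi} [ex phi Q B _ u v c E | ex j xs phi _ _ IH].
  by rewrite (sat_matrix c E Q B); case: ex.
rewrite bet_free_quantify quantifiers_quantify => B Hr u v c L.
have Hxs : size xs <= r := leq_trans (leq_addr _ _) Hr.
have {Hr} Hphi : quantifiers phi <= r := leq_trans (leq_addl _ _) Hr.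
(* A universal block is a negated existential one: a counterexample in [u] is carried to one in [v],
   so Spoiler starts in [u] in both cases. *)
case: ex IH => /= IH; last rewrite !sat_quantify_all => N; last apply: contra N.
  case/sat_quantify_ex=> f; rewrite size_map => Hf Hsat.
  have [u' [v' [c' [g [[Eu Ev L' Hg] [Efu Egv]]]]]] := game_le_move c L Hxs Hf.
  apply/sat_quantify_ex; exists g; first by rewrite size_map.
  rewrite (eq_sat _ (e2 := pos v' c')) // -Ev.
  apply: (IH B Hphi _ _ c' L'); rewrite Eu.
  by rewrite -(eq_sat _ (fun y _ => Efu y)).
case/sat_quantify_ex=> f; rewrite size_map => Hf Hsat.
have [u' [v' [c' [g [[Eu Ev L' Hg] [Efu Egv]]]]]] := game_le_move c L Hxs Hf.
apply/sat_quantify_ex; exists g; first by rewrite size_map.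
rewrite (eq_sat _ (e2 := pos v' c')) // -Ev /=.
apply: contra (IH B Hphi _ _ c' L') _.
by rewrite Eu -[~~ _]/(sat _ _ (FNot phi)) -(eq_sat _ (fun y _ => Efu y)).
Qed.

End Game.

(** * Games on powers of a word *)

Section Powers.
Variable A : finType.

Definition pow (N : nat) (w : seq A) : seq A := flatten (nseq N w).

Lemma powD M N w : pow (M + N) w = pow M w ++ pow N w.
Proof. by rewrite /pow nseqD flatten_cat. Qed.

Lemma size_pow N w : size (pow N w) = N * size w.
Proof. by elim: N => //= N IH; rewrite /pow /= size_cat -/(pow N w) IH mulSn. Qed.

(** A factor that received no pebble in [t] rounds; the empty lists keep the rounds aligned with the
    rest of the word. *)
Definition unmarked (t : nat) (w : seq A) : seq (marked A) :=
  [seq (a, nseq t [::]) | a <- w].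

Lemma unmarked_cat t w1 w2 :
  unmarked t (w1 ++ w2) = unmarked t w1 ++ unmarked t w2.
Proof. exact: map_cat. Qed.

Lemma filter_unmarked t w : filter (@touched A) (unmarked t w) = [::].
Proof.
elim: w => //= a w ->; rewrite ifF // /touched /=.
by elim: t => //= t ->.
Qed.

Lemma mark_unmarked t w n : n = size w ->
  mark (unmarked t w) (nseq n [::]) = unmarked t.+1 w.
Proof. by move=> ->; rewrite mark_nils ?size_map // -map_comp. Qed.

(** Pigeonhole: [r] pebbles cannot hit [r.+1] disjoint runs of [g] blocks of size [s]. A run that is
    hit is dropped together with at least one pebble. *)
Lemma untouched_run r g s N (m : seq (seq nat)) :
  size m = N * s -> size (flatten m) <= r -> r.+1 * g <= N ->
  exists i m1 m2, [/\ m = m1 ++ nseq (g * s) [::] ++ m2, size m1 = i * s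
                    & i + g <= N].
Proof.
elim: r N m => [|r IH] N m Em Fm HN; rewrite -(cat_take_drop (g * s) m).
all: have Ht : size (take (g * s) m) = g * s
  by rewrite size_takel // Em leq_mul2r; apply/orP; right; nia.
all: move: Fm; rewrite -{1}(cat_take_drop (g * s) m) flatten_cat size_cat.
all: have [/eqP F0 _ | Fpos Fm] := boolP (size (flatten (take (g * s) m)) == 0);
  first by exists 0, [::], (drop (g * s) m); split=> //; [rewrite {1}(flatten_eq0 F0) Ht | nia].
- by exfalso; lia.
have [||| i [m1 [m2 [E E1 Hi]]]] := IH (N - g) (drop (g * s) m).
- by rewrite size_drop Em mulnBl.
- by lia.
- by lia.
exists (g + i), (take (g * s) m ++ m1), m2; split; last by nia.
  by rewrite {1}E -catA.
by rewrite size_cat Ht E1 mulnDl.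
Qed.

(** Duplicator copies the pebbles outside [x]. On [x] and [y] the round only adds an empty list, and
    the remaining [j] rounds follow the hypothesis with the sides exchanged. *)
Lemma game_le_splice r j t (x y : seq A) u1 u2 m1 m2 :
  game_le r j (unmarked t.+1 y) (unmarked t.+1 x) ->
  size m1 = size u1 ->
  size m1 + (size x + size m2) = size (u1 ++ unmarked t x ++ u2) ->
  exists m', [/\ size m' = size (u1 ++ unmarked t y ++ u2),
    size (flatten m') = size (flatten (m1 ++ nseq (size x) [::] ++ m2))
  & game_le r j (mark (u1 ++ unmarked t y ++ u2) m')
      (mark (u1 ++ unmarked t x ++ u2) (m1 ++ nseq (size x) [::] ++ m2))].
Proof.
move=> L E1; rewrite !size_cat size_map => E2.
exists (m1 ++ nseq (size y) [::] ++ m2); split.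
- by rewrite !size_cat size_nseq size_map; lia.
- by rewrite !flatten_cat !flatten_nils !size_cat.
rewrite !(mark_cat _ _ E1) !mark_cat ?size_nseq ?size_map //.
apply: game_le_cat; first exact: game_le_refl.
apply: game_le_cat; last exact: game_le_refl.
by rewrite !mark_unmarked.
Qed.

(** In [threshold r j.+1] copies, a round of at most [r] pebbles leaves a run of
    [(threshold r j).+1] untouched: removing one copy leaves enough for [j] rounds. *)
Fixpoint threshold (r j : nat) : nat :=
  if j is j.+1 then r.+1 * (threshold r j).+1 else 0.

Lemma leq_threshold r i j : i <= j -> threshold r i <= threshold r j.
Proof.
elim: j => [|j IH]; first by rewrite leqn0 => /eqP->.
rewrite leq_eqVlt => /orP[/eqP->//|/IH H] /=; nia.
Qed.

Lemma pow_replace r j t g N (w y : seq A) (m : seq (seq nat)) :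
  size m = size (unmarked t (pow N w)) -> size (flatten m) <= r ->
  r.+1 * g <= N -> game_le r j (unmarked t.+1 y) (unmarked t.+1 (pow g w)) ->
  exists2 i, i + g <= N &
  exists m', [/\ size m' = size (unmarked t (pow i w ++ y ++ pow (N - g - i) w)),
    size (flatten m') = size (flatten m)
  & game_le r j (mark (unmarked t (pow i w ++ y ++ pow (N - g - i) w)) m')
      (mark (unmarked t (pow N w)) m)].
Proof.
rewrite size_map size_pow => Em Fm Hg L.
have [i [m1 [m2 [E E1 Hi]]]] := untouched_run Em Fm Hg.
exists i => //; have EN : N = i + (g + (N - g - i)) by lia.
rewrite {3}EN !powD !unmarked_cat E -size_pow.
apply: game_le_splice L _ _; first by rewrite size_map size_pow.
move: Em; rewrite E {1}EN !size_cat !size_map size_nseq !size_pow; lia.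
Qed.

Lemma pow_succ r j t N w : threshold r j <= N ->
  game_le r j (unmarked t (pow N w)) (unmarked t (pow N.+1 w)) /\
  game_le r j (unmarked t (pow N.+1 w)) (unmarked t (pow N w)).
Proof.
elim: j t N => [|j IH] t N /= HN; first by rewrite !filter_unmarked.
split=> m Em Fm.
(* Duplicator's answer lengthens the untouched run by one copy. *)
- have [_ L] := IH t.+1 (threshold r j).+1 (leqnSn _).
  have [i Hi] := pow_replace Em Fm HN L.
  by rewrite -!powD; have -> : i + ((threshold r j).+2 + (N - (threshold r j).+1 - i)) = N.+1 by lia.
(* Duplicator's answer shortens the untouched run by one copy, to exactly the threshold. *)
- have [L _] := IH t.+1 (threshold r j) (leqnn _).
  have [i Hi] := pow_replace Em Fm (leqW HN) L.
  by rewrite -!powD; have -> : i + (threshold r j + (N.+1 - (threshold r j).+1 - i)) = N by lia.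
Qed.

Lemma pow_game_le r j t M N w : threshold r j <= M -> threshold r j <= N ->
  game_le r j (unmarked t (pow M w)) (unmarked t (pow N w)).
Proof.
have step M' d : threshold r j <= M' ->
  game_le r j (unmarked t (pow M' w)) (unmarked t (pow (M' + d) w)) /\
  game_le r j (unmarked t (pow (M' + d) w)) (unmarked t (pow M' w)).
  move=> HM; elim: d => [|d [IH1 IH2]]; first by rewrite addn0; split; apply: game_le_refl.
  have [S1 S2] := pow_succ (r := r) (j := j) t (N := M' + d) w (leq_trans HM (leq_addr _ _)).
  rewrite addnS; split; [exact: game_le_trans IH1 S1 | exact: game_le_trans S2 IH2].
move=> HM HN; case/orP: (leq_total M N) => /subnKC <-.
  by have [] := step M (N - M) HM.
by have [] := step N (M - N) HN.
Qed.

(** * The trees and the games between them *)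

Variable a : nat -> A.

Fixpoint trees (p k : nat) : seq A * seq A :=
  if k is k'.+1 then
    let: (T, F) := trees p k' in
    (a k :: pow p T ++ F ++ pow p T, a k :: pow p T ++ T ++ pow p T)
  else ([::], [:: a 0]).

Definition true_tree p k := (trees p k).1.
Definition false_tree p k := (trees p k).2.

Lemma true_treeS p k : true_tree p k.+1 =
  a k.+1 :: pow p (true_tree p k) ++ false_tree p k ++ pow p (true_tree p k).
Proof. by rewrite /true_tree /false_tree /=; case: (trees p k). Qed.

Lemma false_treeS p k : false_tree p k.+1 =
  a k.+1 :: pow p (true_tree p k) ++ true_tree p k ++ pow p (true_tree p k).
Proof. by rewrite /true_tree /false_tree /=; case: (trees p k). Qed.

(** The bound on [p] guarantees an untouched run of [2f+1] copies of the smaller true tree, where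
    powers above [f] are indistinguishable in the rounds at hand; the middle copy is exchanged. *)
Lemma false_le_true r p k j t :
  j <= k -> r.+1 * (threshold r k).*2.+1 <= p ->
  game_le r j (unmarked t (false_tree p k)) (unmarked t (true_tree p k)).
Proof.
elim: k j t => [|k IH] [|j] t Hj Hp //.
- exact: etrans (filter_unmarked _ _) (esym (filter_unmarked _ _)).
- exact: etrans (filter_unmarked _ _) (esym (filter_unmarked _ _)).
have := leq_threshold r Hj.
have Epow := pow_game_le (r := r) (j := j.+1).
move: (threshold r j.+1) Epow => f Epow Hf.
rewrite false_treeS true_treeS; set T := true_tree p k; set F := false_tree p k.
rewrite -[_ :: _]cat1s -[a k.+1 :: (_ ++ F ++ _)]cat1s.
rewrite unmarked_cat [X in game_le _ _ _ X]unmarked_cat.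
apply: game_le_cat; first exact: game_le_refl.
have -> : pow p T ++ T ++ pow p T = pow (p + p.+1) T by rewrite powD.
(* The middle copy becomes [F]. For the next [j] rounds Spoiler starts on this side, which is the
   induction hypothesis one level down. *)
have L : game_le r j (unmarked t.+1 (pow f T ++ F ++ pow f T))
                     (unmarked t.+1 (pow (f + f.+1) T)).
  rewrite powD -[pow f.+1 T]/(T ++ pow f T) !unmarked_cat.
  apply: game_le_cat; first exact: game_le_refl.
  apply: game_le_cat; last exact: game_le_refl.
  apply: IH => //; apply: leq_trans Hp.
  by rewrite leq_mul2l ltnS leq_double leq_threshold.
move=> m Em Fm.
have Hg : r.+1 * (f + f.+1) <= p + p.+1.
  apply: (@leq_trans p); last exact: leq_addr.
  by apply: leq_trans Hp; rewrite leq_mul2l addnS addnn ltnS leq_double.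
have [i Hi [m' [Em' Fm' L']]] := pow_replace Em Fm Hg L.
(* The answer was found in a word whose powers around [F] have the wrong exponents. All exponents
   are at least [f], so it can be transferred to the true tree as a further Spoiler move. *)
have X : game_le r j.+1
    (unmarked t (pow i T ++ (pow f T ++ F ++ pow f T) ++ pow (p + p.+1 - (f + f.+1) - i) T))
    (unmarked t (pow p T ++ F ++ pow p T)).
  have Hpf : f <= p by apply: leq_trans Hf _; apply: leq_trans Hp; rewrite -addnn; nia.
  rewrite -!catA (catA (pow i T)) -!powD !unmarked_cat.
  apply: game_le_cat; first by apply: Epow => //; apply: leq_addl.
  apply: game_le_cat; first exact: game_le_refl.
  by apply: Epow => //; apply: leq_addr.
have [|m'' [Em'' Fm'' L'']] := X m' Em'; first by rewrite Fm'.
by exists m''; split; rewrite ?Fm'' //; apply: game_le_trans L'' L'.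
Qed.

(** The trees of level [k.+1] differ only in the middle block, where the true tree has the false one
    of level [k] and conversely; hence the bound [j <= k]. *)
Lemma true_le_false r p k j t :
  j <= k -> r.+1 * (threshold r k).*2.+1 <= p ->
  game_le r j (unmarked t (true_tree p k.+1)) (unmarked t (false_tree p k.+1)).
Proof.
move=> Hj Hp; rewrite true_treeS false_treeS -[_ :: _]cat1s -[a k.+1 :: (_ ++ true_tree p k ++ _)]cat1s.
rewrite !unmarked_cat; do 2 (apply: game_le_cat; first exact: game_le_refl).
by apply: game_le_cat; [exact: false_le_true | exact: game_le_refl].
Qed.
End Powers.

(** * Winning nodes and their two-variable definition *)

Lemma onth_lt (T : Type) (x0 : T) (s : seq T) i :
  i < size s -> onth s i = Some (nth x0 s i).
Proof. by move=> Hi; rewrite onthE (nth_map x0). Qed.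

Section Language.
Variable n : nat.
Local Notation A := 'I_n.+1.
Implicit Types (w s : seq A) (e : nat -> nat).

(* A node of level [k] is winning, [s] being the part of the word after it. *)
Fixpoint hold (k : nat) (s : seq A) : bool :=
  if k is k'.+1 then
    (fix scan s : bool := if s is b :: s' then
        (b <= k') && (((b == k' :> nat) && ~~ hold k' s') || scan s')
      else false) s
  else false.

Lemma hold_cons k b s : hold k.+1 (b :: s) =
  (b <= k) && (((b == k :> nat) && ~~ hold k s) || hold k.+1 s).
Proof. by []. Qed.


Lemma onth_inord w y k : k <= n ->
  (onth w y == Some (inord k : A)) = (y < size w) && (nth ord0 w y == k :> nat).
Proof.
move=> Hk; case: (ltnP y (size w)) => Hy; last by rewrite onth_default.
rewrite (onth_lt ord0) //=; apply/eqP/eqP => [[->]|E]; first by rewrite inordK.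
by congr Some; apply/val_inj; rewrite /= inordK.
Qed.

Lemma holdP k s : reflect
  (exists i, [/\ i < size s, nth ord0 s i = k :> nat,
     forall z, z < i -> nth ord0 s z <= k & ~~ hold k (drop i.+1 s)])
  (hold k.+1 s).
Proof.
elim: s => [|b s IH]; first by apply: (iffP idP) => // -[i []].
rewrite hold_cons; apply: (iffP andP).
  case=> Hb /orP[/andP[/eqP E Hs]|/IH[i [Hi Ei Ai Di]]].
    by exists 0; rewrite /= drop0.
  by exists i.+1; split=> // -[|z] //; apply: Ai.
case=> -[|i] [Hi E Ai Di].
  by move: E Di; rewrite /= drop0 => -> ->; rewrite leqnn eqxx.
split; first exact: (Ai 0).
apply/orP; right; apply/IH; exists i; split=> // z; exact: (Ai z.+1).
Qed.

Definition low_between k w p y : bool :=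
  [forall z : 'I_(size w), (p < z) && (z < y) ==> (nth ord0 w z <= k)].

(** The description of a losing child by positions, which is the common target of both translations
    into formulas. *)
Lemma holdE k p w : k <= n -> hold k.+1 (drop p.+1 w) =
  [exists y : 'I_(size w), [&& p < y, onth w y == Some (inord k : A),
    low_between k w p y & ~~ hold k (drop y.+1 w)]].
Proof.
move=> Hk; apply/holdP/existsP.
  case=> i []; rewrite size_drop nth_drop drop_drop => Hi E Ai Di.
  have Hy : p.+1 + i < size w by lia.
  exists (Ordinal Hy); apply/and4P; split.
  - by rewrite /=; lia.
  - by rewrite onth_inord // [nat_of_ord _]/= Hy E eqxx.
  - apply/forallP => z; apply/implyP => /andP[Hpz /= Hzi].
    by have := Ai (z - p.+1); rewrite nth_drop subnKC //; apply; lia.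
  - by have <- : i.+1 + p.+1 = (p.+1 + i).+1 by lia.
case=> y /and4P[Hp]; rewrite onth_inord // => /andP[Hy /eqP E] /forallP Ay Dy.
exists (y - p.+1); rewrite size_drop nth_drop subnKC // drop_drop addSn subnK //.
split=> //; first by lia.
move=> z Hz; rewrite nth_drop.
have Hz' : p.+1 + z < size w by lia.
by have /implyP/= := Ay (Ordinal Hz'); apply; lia.
Qed.

Definition conj (fs : seq (formula A)) : formula A := foldr (@FAnd A) FTrue fs.

Lemma sat_conj w e fs : sat w e (conj fs) = all (sat w e) fs.
Proof. by elim: fs => //= f fs ->. Qed.

Definition above (k : nat) : seq A := [seq b : A <- enum A | k < b].

Lemma mem_above k b : (b \in above k) = (k < b).
Proof. by rewrite mem_filter mem_enum andbT. Qed.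

(* [1 - x] is the other one of the two variables. *)
Fixpoint fo2 (k x : nat) : formula A :=
  if k is k'.+1 then
    FEx (1 - x) (FAnd (FLt x (1 - x)) (FAnd (FLetter (inord k') (1 - x))
      (FAnd (conj [seq FNot (FBet b x (1 - x)) | b <- above k'])
      (FNot (fo2 k' (1 - x))))))
  else FNot FTrue.

Lemma sat_fo2 w e k x : k <= n -> x < 2 ->
  sat w e (fo2 k x) = hold k (drop (e x).+1 w).
Proof.
elim: k e x => // k IH e x Hk Hx.
rewrite holdE /=; last exact: ltnW.
apply: eq_existsb => y; rewrite IH; [|exact: ltnW|by lia].
rewrite update_same update_other; last by lia.
congr [&& _, _, _ & _]; rewrite sat_conj all_map.
apply/allP/forallP => [H z | H b].
  apply/implyP => /andP[Hpz Hzy]; rewrite leqNgt; apply/negP => Hb.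
  have /= := H (nth ord0 w z); rewrite mem_above => /(_ Hb)/existsP; apply.
  exists z; rewrite update_same update_other; last by lia.
  by rewrite Hpz Hzy (onth_lt ord0) //=.
rewrite mem_above /= update_same update_other; last by lia.
move=> Hb; apply/existsP => -[z /and3P[Hpz Hzy]].
rewrite (onth_lt ord0) //= => /eqP[E].
by have := H z; rewrite Hpz Hzy E leqNgt Hb.
Qed.

Definition root_holds (k : nat) w : bool :=
  [exists x : 'I_(size w),
    (onth w x == Some (inord k : A)) && hold k (drop x.+1 w)].

Definition fo2_sentence (k : nat) : formula A :=
  FEx 0 (FAnd (FLetter (inord k) 0) (fo2 k 0)).

Lemma sat_fo2_sentence w e k : k <= n ->
  sat w e (fo2_sentence k) = root_holds k w.
Proof. by move=> Hk; rewrite /=; apply: eq_existsb => x; rewrite sat_fo2 // update_same. Qed.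

Lemma two_variable_fo2 k x : x < 2 -> two_variable (fo2 k x).
Proof.
elim: k x => //= k IH x Hx; have Hy : 1 - x < 2 by lia.
rewrite Hx Hy IH //= andbT.
by elim: (above k) => //= b bs ->; rewrite Hx Hy.
Qed.

Lemma mem_free_ex x y (f : formula A) :
  (y \in free_vars (FEx x f)) = (y != x) && (y \in free_vars f).
Proof. by rewrite mem_filter. Qed.

Lemma mem_free_and x (f g : formula A) :
  (x \in free_vars (FAnd f g)) = (x \in free_vars f) || (x \in free_vars g).
Proof. exact: mem_cat. Qed.

Lemma free_fo2 k x y : x < 2 -> y \in free_vars (fo2 k x) -> y = x.
Proof.
elim: k x y => // k IH x y Hx.
rewrite [fo2 _ _]/= mem_free_ex => /andP[/eqP Ny]; rewrite /= !inE mem_cat.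
case/or4P=> [/eqP//|/eqP//|/eqP//|/orP[]].
  by elim: (above k) => //= b bs IHb; rewrite !inE => /or3P[/eqP//|/eqP//|/IHb].
by move/(IH (1 - x)) => E; case: Ny; apply: E; lia.
Qed.

Lemma fo2_sentenceP k :
  two_variable (fo2_sentence k) /\ sentence (fo2_sentence k).
Proof.
split; first by rewrite /= two_variable_fo2.
rewrite /sentence; case E: (free_vars _) => [|y s] //.
have: y \in free_vars (fo2_sentence k) by rewrite E mem_head.
by rewrite mem_free_ex inE => /andP[/eqP Ny /orP[/eqP//|Hy]]; case: Ny; apply: free_fo2 Hy.
Qed.

(** * A prenex definition of the language in FO[<] *)

Definition prefix (qs : seq (bool * nat)) (phi : formula A) : formula A :=
  foldr (fun q f => if q.1 then FEx q.2 f else FAll q.2 f) phi qs.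

Definition dual (qs : seq (bool * nat)) := [seq (~~ q.1, q.2) | q <- qs].

Lemma sat_prefix_dual w e qs phi :
  sat w e (prefix (dual qs) (FNot phi)) = ~~ sat w e (prefix qs phi).
Proof.
elim: qs e => //= -[[] x] qs IH e /=; rewrite ?negb_exists ?negb_forall.
  by apply: eq_forallb => p; rewrite IH.
by apply: eq_existsb => p; rewrite IH.
Qed.

Lemma eq_sat_update w e x p phi : x \notin free_vars phi ->
  sat w (update e x p) phi = sat w e phi.
Proof.
by move=> Hx; apply: eq_sat => y Hy; apply: update_other; apply: contraNneq Hx => <-.
Qed.

(* The word must be nonempty: a vacuous quantifier is not neutral otherwise. *)
Lemma sat_prefix_and w e qs f g : 0 < size w ->
  (forall q, q \in qs -> q.2 \notin free_vars f) ->
  sat w e (prefix qs (FAnd f g)) = sat w e f && sat w e (prefix qs g).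
Proof.
move=> Hw; elim: qs e => //= q qs IH e Hqs.
have Hq : q.2 \notin free_vars f by apply: Hqs; rewrite mem_head.
have E p : sat w (update e q.2 p) (prefix qs (FAnd f g)) =
           sat w e f && sat w (update e q.2 p) (prefix qs g).
  rewrite IH ?(eq_sat_update _ _ _ Hq) // => q' Hq'.
  by apply: Hqs; rewrite inE Hq' orbT.
case: q.1 => /=.
  apply/existsP/andP => [[p]|[Hf /existsP[p Hg]]].
    by rewrite E => /andP[-> Hg]; split=> //; apply/existsP; exists p.
  by exists p; rewrite E Hf.
apply/forallP/andP => [H|[Hf /forallP Hg] p]; last by rewrite E Hf Hg.
split; first by have := H (Ordinal Hw); rewrite E => /andP[].
by apply/forallP => p; have := H p; rewrite E => /andP[].
Qed.

(** Equal neighbouring quantifiers are merged into one block. The number of blocks stays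
    unspecified, as any level will do. *)
Lemma prefix_blocks b x qs phi : quantifier_free phi ->
  exists k xs psi, prefix ((b, x) :: qs) phi = quantify b (x :: xs) psi /\
    alternating_prefix (~~ b) k psi.
Proof.
move=> Q; elim: qs b x => [|[b' y] qs IH] b x.
  by exists 0, [::], phi; split; [case: b | constructor].
have [k [xs [psi [E H]]]] := IH b' y.
have [Eb|Nb] := eqVneq b' b.
  by exists k, (y :: xs), psi; rewrite -Eb; split=> //; move: E => /= ->; case: (b').
exists k.+1, [::], (prefix ((b', y) :: qs) phi).
split; first by case: (b).
have -> : ~~ b = b' by case: b b' Nb {IH E H} => [] [].
by rewrite E; constructor.
Qed.

(** The between predicate becomes an implication about [k.*2.+1]: if it lies between the parent
    [k.+1.*2] and the child [k.*2], its letter is not above [k]. *)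
Definition guard (k : nat) : formula A :=
  FAnd (FLt k.+1.*2 k.*2) (FAnd (FLetter (inord k) k.*2)
    (FOr (FNot (FAnd (FLt k.+1.*2 k.*2.+1) (FLt k.*2.+1 k.*2)))
         (conj [seq FNot (FLetter b k.*2.+1) | b <- above k]))).

(* A node of level [k] is held by the variable [k.*2], and [k.*2.+1] ranges over
   the positions between it and its parent. *)
Fixpoint matrix (k : nat) : formula A :=
  if k is k'.+1 then FAnd (guard k') (FNot (matrix k')) else FNot FTrue.

(** The inner prefix is dualised because [matrix] negates the inner matrix. *)
Fixpoint quantifier_prefix (k : nat) : seq (bool * nat) :=
  if k is k'.+1 then
    [:: (true, k'.*2), (false, k'.*2.+1) & dual (quantifier_prefix k')]
  else [::].

Lemma mem_dual qs q : (q \in dual qs) = ((~~ q.1, q.2) \in qs).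
Proof.
apply/mapP/idP => [[[b x] Hq ->]|Hq]; first by rewrite negbK.
by exists (~~ q.1, q.2) => //=; rewrite negbK; case: q {Hq}.
Qed.

Lemma quantifier_prefix_lt k q : q \in quantifier_prefix k -> q.2 < k.*2.
Proof.
elim: k q => //= k IH q; rewrite !inE mem_dual => /or3P[/eqP->|/eqP->|/IH] /=; lia.
Qed.

Lemma quantifier_prefix_mem k x : x < k.*2 -> x \in unzip2 (quantifier_prefix k).
Proof.
elim: k => //= k IH; rewrite !inE => Hx.
have -> : unzip2 (dual (quantifier_prefix k)) = unzip2 (quantifier_prefix k).
  by rewrite /unzip2 -map_comp.
case: (ltngtP x k.*2) => [/IH->||//]; rewrite ?orbT // => Hk.
have -> : x = k.*2.+1 by lia.
by rewrite eqxx.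
Qed.

(** The lower bound separates the guard from the variables bound further inside, which are below
    [k.*2], so the guard can leave their scope. *)
Lemma free_guard k x : x \in free_vars (guard k) -> k.*2 <= x <= k.+1.*2.
Proof.
rewrite /guard /= !inE.
have H : x \in free_vars (conj [seq FNot (FLetter b k.*2.+1) | b <- above k]) ->
    x = k.*2.+1.
  by elim: (above k) => //= b bs IH; rewrite inE => /orP[/eqP|/IH].
repeat case/orP; try (by move/eqP=> ->; lia); by move/H; lia.
Qed.

Lemma sat_matrix_prefix w e k : k <= n -> 0 < size w ->
  sat w e (prefix (quantifier_prefix k) (matrix k)) =
  hold k (drop (e k.*2).+1 w).
Proof.
elim: k e => [|k IH] e Hk Hw //; rewrite holdE /=; last exact: ltnW.
apply: eq_existsb => y.
rewrite -[in RHS](update_same e k.*2 y).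
rewrite -[e k.+1.*2](@update_other e k.*2 _ y); last by lia.
move: (update e k.*2 y) => {}e.
have G z : sat w (update e k.*2.+1 (nat_of_ord z)) (guard k) =
    [&& e k.+1.*2 < e k.*2, onth w (e k.*2) == Some (inord k : A)
      & (e k.+1.*2 < z) && (z < e k.*2) ==> (nth ord0 w (z : 'I_(size w)) <= k)].
  rewrite /guard [LHS]/= update_same !update_other; try lia.
  congr [&& _, _ & _]; rewrite implybE; congr (_ || _).
  rewrite sat_conj all_map; apply/allP/idP => [H | H b].
    rewrite leqNgt; apply/negP => Hb; have := H (nth ord0 w z).
    by rewrite mem_above => /(_ Hb); rewrite /= update_same (onth_lt ord0) // eqxx.
  rewrite mem_above /= update_same (onth_lt ord0) // => Hb.
  by apply/negP => /eqP[E]; move: H; rewrite E leqNgt Hb.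
under eq_forallb => z.
  rewrite sat_prefix_and //; last first.
    move=> q; rewrite mem_dual => /quantifier_prefix_lt /= Hq.
    by apply/negP => /free_guard; lia.
  rewrite sat_prefix_dual IH //; last exact: ltnW.
  rewrite [update _ _ _ k.*2]update_other; last by lia.
  rewrite G; over.
apply/forallP/and4P => [H | [H1 H2 /forallP H3 H4] z]; last first.
  by rewrite H1 H2 H4 H3.
(* The conjuncts independent of [z] are read off at one instance, position 0 of the nonempty
   word. *)
have := H (Ordinal Hw); rewrite -!andbA => /and4P[-> -> _ ->].
by split=> //; apply/forallP => z; have := H z; move=> /andP[/and3P[]].
Qed.

Definition prenex_sentence (k : nat) : formula A :=
  prefix ((true, k.*2) :: quantifier_prefix k)
         (FAnd (FLetter (inord k) k.*2) (matrix k)).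

Lemma sat_prenex_sentence w e k : k <= n ->
  sat w e (prenex_sentence k) = root_holds k w.
Proof.
move=> Hk.
rewrite /prenex_sentence /=; apply: eq_existsb => x.
have Hw : 0 < size w by apply: leq_ltn_trans (ltn_ord x).
rewrite sat_prefix_and //=; last first.
  by move=> q /quantifier_prefix_lt Hq; rewrite inE neq_ltn Hq.
by rewrite sat_matrix_prefix // update_same.
Qed.

Lemma free_prefix qs f x : x \in free_vars (prefix qs f) ->
  x \in free_vars f /\ x \notin unzip2 qs.
Proof.
elim: qs => //= q qs IH; rewrite inE negb_or.
case: q.1 => /=; rewrite mem_filter => /andP[-> /IH[]] //.
Qed.

Lemma free_matrix k x : x \in free_vars (matrix k) -> x <= k.*2.
Proof.
elim: k => // k IH; rewrite [matrix _]/= mem_free_and => /orP[/free_guard|]; first by lia.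
by move/IH; lia.
Qed.

Lemma quantifier_free_matrix k : quantifier_free (matrix k) /\ bet_free (matrix k).
Proof.
elim: k => //= k [-> ->]; rewrite !andbT.
by elim: (above k) => //= b bs [].
Qed.

Lemma bet_free_prefix qs f : bet_free (prefix qs f) = bet_free f.
Proof. by elim: qs => //= q qs <-; case: q.1. Qed.

(** This places the language in FO[<], so that its alternation depth exists. *)
Lemma prenex_sigma k : exists j, sigma_sentence j (prenex_sentence k).
Proof.
have [Q B] := quantifier_free_matrix k.
have Q' : quantifier_free (FAnd (FLetter (inord k) k.*2) (matrix k)) by [].
have [j [xs [psi [E H]]]] := prefix_blocks true k.*2 (quantifier_prefix k) Q'.
exists j.+1; split.
- by rewrite /prenex_sentence E; constructor.
- by rewrite /prenex_sentence bet_free_prefix.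
rewrite /sentence; case Ef: (free_vars _) => [|y s] //.
have /free_prefix[] : y \in free_vars (prenex_sentence k) by rewrite Ef mem_head.
rewrite [_ \in free_vars _]in_cons inE negb_or => Hy /andP[Ny].
case/negP; apply: quantifier_prefix_mem; rewrite ltn_neqAle Ny.
by case/orP: Hy => [/eqP->|Hy] /=; [exact: leqnn | exact: free_matrix].
Qed.

(** * Winning and losing roots of the trees *)

Local Notation T p k := (true_tree (fun i => inord i : A) p k).
Local Notation F p k := (false_tree (fun i => inord i : A) p k).

(** The condition under which [s] adds no descendants to a node of level [k] before it: the scan for
    its children stops at once. *)
Definition low_head k s : bool := if s is b :: _ then k <= b else true.

Lemma hold_low_head k s : low_head k s -> hold k s = false.
Proof. by case: k s => [|k] [|b s] //= Hb; rewrite leqNgt Hb. Qed.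

Lemma hold_skip k s1 s2 : all (fun b : A => b < k) s1 ->
  hold k.+1 (s1 ++ s2) = hold k.+1 s2.
Proof.
elim: s1 => // b s1 IH /andP[Hb /IH <-].
by rewrite cat_cons hold_cons (ltnW Hb) (ltn_eqF Hb).
Qed.

Lemma all_pow (P : pred A) N w : all P w -> all P (pow N w).
Proof. by move=> Hw; elim: N => //= N IH; rewrite /pow /= all_cat Hw. Qed.

Lemma trees_letters p k : k <= n ->
  all (fun b : A => b <= k) (T p k) /\ all (fun b : A => b <= k) (F p k).
Proof.
elim: k => [|k IH] Hk; first by rewrite /= inordK.
have [HT HF] := IH (ltnW Hk).
have sub s : all (fun b : A => b <= k) s -> all (fun b : A => b <= k.+1) s.
  by apply: sub_all => b /leqW.
rewrite true_treeS false_treeS /= !all_cat !all_pow ?inordK //; try exact: sub.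
by rewrite leqnn !sub.
Qed.

Lemma low_head_trees p k s : k <= n -> low_head k s ->
  low_head k (T p k ++ s) /\ low_head k (F p k ++ s).
Proof.
case: k => [|k] Hk Hs; first by split; case: (_ ++ _).
by rewrite true_treeS false_treeS /= inordK.
Qed.

Lemma low_head_pow p k N s : k <= n -> low_head k s ->
  low_head k (pow N (T p k) ++ s).
Proof.
move=> Hk Hs; elim: N => //= N IH; rewrite /pow /= -catA.
by have [] := low_head_trees p Hk IH.
Qed.

Lemma hold_pow p k N s : k <= n ->
  (forall s', low_head k s' -> hold k.+1 (T p k ++ s') = hold k.+1 s') ->
  low_head k s -> hold k.+1 (pow N (T p k) ++ s) = hold k.+1 s.
Proof.
move=> Hk HT Hs; elim: N => // N IH; rewrite [pow _ _]/(_ ++ pow N (T p k)) -catA HT //.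
exact: low_head_pow.
Qed.

Lemma low_headW k s : low_head k.+1 s -> low_head k s.
Proof. by case: s => //= b s /ltnW. Qed.

(** Only the block [F] is a losing child. The hypothesis is [hold_trees] at level [k], kept abstract
    so that this lemma can serve inside its induction. *)
Lemma hold_bodies p k s : k <= n ->
  (forall s', low_head k s' ->
    hold k.+1 (T p k ++ s') = hold k.+1 s' /\ hold k.+1 (F p k ++ s')) ->
  low_head k.+1 s ->
  hold k.+1 ((pow p (T p k) ++ F p k ++ pow p (T p k)) ++ s) /\
  hold k.+1 ((pow p (T p k) ++ T p k ++ pow p (T p k)) ++ s) = false.
Proof.
move=> Hk H Hs; have Hs' := low_headW Hs.
have HT s' Hs1 := (H s' Hs1).1.
have HP := low_head_pow p p Hk Hs'.
have [HPT HPF] := low_head_trees p Hk HP.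
rewrite -!catA (hold_pow _ Hk HT HPF) (hold_pow _ Hk HT HPT) (HT _ HP).
by rewrite (hold_pow _ Hk HT Hs') (hold_low_head Hs) (H _ HP).2.
Qed.

(** A winning child leaves the verdict to the rest of the word, a losing child makes the parent win.
    At level 0 these are the empty word and a leaf. *)
Lemma hold_trees p k s : k <= n -> low_head k s ->
  hold k.+1 (T p k ++ s) = hold k.+1 s /\ hold k.+1 (F p k ++ s).
Proof.
elim: k s => [|k IH] s Hk Hs; first by rewrite /= inordK.
have Hk' := ltnW Hk.
have [LT LF] := trees_letters p Hk'.
have [HF HT] := hold_bodies Hk' (fun s' => IH s' Hk') Hs.
rewrite true_treeS false_treeS !cat_cons !hold_cons !inordK // leqnn eqxx.
rewrite HF HT; split; last by [].
rewrite andTb [_ && ~~ _]/= orFb hold_skip // !all_cat !all_pow //.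
by apply/and3P; split.
Qed.

Lemma root_holds_trees p k : k < n ->
  root_holds k.+1 (T p k.+1) /\ root_holds k.+1 (F p k.+1) = false.
Proof.
move=> Hk; have Hk' := ltnW Hk.
have [|HF HT] := @hold_bodies p k [::] Hk' _ isT.
  by move=> s'; apply: hold_trees.
rewrite !cats0 in HF HT.
have [LT LF] := trees_letters p Hk'.
rewrite true_treeS false_treeS; split.
  apply/existsP; exists (Ordinal (ltn0Sn _)); apply/andP; split; first exact/eqP.
  by rewrite [drop _ _]/= drop0.
apply/negbTE/existsP => -[[[|x] Hx] /andP[]].
  by rewrite [drop _ _]/= drop0 HT.
(* No root can sit beyond the head, since the letters of the body are at most [k]. *)
rewrite onth_inord // => /andP[_ /eqP /= E].
set body := (_ ++ _) in Hx E.
have Hbody : all (fun b : A => b <= k) body by rewrite !all_cat !all_pow // LT.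
by have := all_nthP ord0 Hbody x Hx; rewrite /= E ltnn.
Qed.

End Language.

(** * Boolean combinations and the lower bound on the depth *)

Lemma boolean_combination_invariant (A : finType) r j (u v : seq (marked A)) phi :
  boolean_combination (sigma_sentence j) phi -> quantifiers phi <= r ->
  game_le r j u v -> game_le r j v u ->
  sat (unzip1 u) (fun=> 0) phi = sat (unzip1 v) (fun=> 0) phi.
Proof.
move=> H + Luv Lvu; elim: H => {phi} [phi [Hp B S] Hr|phi _ IH /= /IH -> //||].
- have closed w e : sat w (fun=> 0) phi = sat w e phi.
    by apply: eq_sat => x; rewrite (nilP S).
  (* Sentences ignore the assignment, so it may be replaced by one of the form [pos] that the game
     handles. *)
  rewrite (closed _ (pos u id)) (closed (unzip1 v) (pos v id)).
  by apply/idP/idP; apply: (game_le_sat Hp B Hr id).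
- move=> f g _ IHf _ IHg /= Hr.
  by rewrite IHf ?IHg //; apply: leq_trans Hr; [exact: leq_addl | exact: leq_addr].
- move=> f g _ IHf _ IHg /= Hr.
  by rewrite IHf ?IHg //; apply: leq_trans Hr; [exact: leq_addl | exact: leq_addr].
Qed.

Lemma unzip1_unmarked (A : finType) t (w : seq A) : unzip1 (unmarked t w) = w.
Proof. by rewrite /unzip1 -map_comp map_id. Qed.

Lemma alternation_depth_exists (A : finType) (L : language A) k :
  bool_sigma_definable k L -> exists k', alternation_depth L k'.
Proof.
elim/ltn_ind: k => k IH Hk.
(* Descent to the least level; whether a smaller one defines [L] is decided by excluded middle. *)
have [[j Hj Lj]|N] := classic (exists2 j, j < k & bool_sigma_definable j L).
  exact: IH Hj Lj.
exists k; split=> // j Hj; rewrite leqNgt; apply/negP => Hlt.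
by apply: N; exists j.
Qed.

Theorem theorem3p1 :
  forall d : nat, 1 <= d ->
  exists (A : finType) (L : language A),
    FO2_bet_definable L /\
    exists k : nat, alternation_depth L k /\ d < k.
Proof.
move=> d _; pose A : finType := 'I_d.+2.
pose L : language A := fun w => root_holds d.+1 w.
exists A, L; split.
  have [Htwo Hsent] := fo2_sentenceP d.+1 d.+1.
  by exists (fo2_sentence d.+1 d.+1); split=> // w; rewrite sat_fo2_sentence.
have [j Hj] := prenex_sigma d.+1 d.+1.
have [|k Hk] := @alternation_depth_exists A L j.
  exists (prenex_sentence d.+1 d.+1); split; first exact: BC_base.
  by move=> w; rewrite sat_prenex_sentence.
exists k; split=> //; rewrite ltnNge; apply/negP => Hkd.
have [[phi [Hphi Dphi]] _] := Hk.
(* The trees are chosen after [phi]: [p] depends on its number of quantifiers, and level [d.+1] of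
   the threshold serves both directions below. *)
pose r := quantifiers phi; pose p := r.+1 * (threshold r d.+1).*2.+1.
have [HT HF] := @root_holds_trees d.+1 p d (ltnSn d).
have Hp : r.+1 * (threshold r d).*2.+1 <= p.
  by rewrite leq_mul2l ltnS leq_double leq_threshold.
pose a i : A := inord i.
(* Here the assumption [k <= d] enters in full; the other direction would allow [k <= d.+1]. *)
have LTF := @true_le_false A a r p d k 0 Hkd Hp.
have LFT := @false_le_true A a r p d.+1 k 0 (leqW Hkd) (leqnn _).
have := boolean_combination_invariant Hphi (leqnn _) LTF LFT.
rewrite !unzip1_unmarked => E.
have /(Dphi _) S : L (true_tree a p d.+1) by [].
by have : L (false_tree a p d.+1) by [apply/Dphi; rewrite -E]; rewrite /L HF.
Qed.
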